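(* Let $R$ be a maximal subring of a ring $T$ and $I$ be a nonzero ideal of $T$ such that $R\cap I=0$. Then either $Z({}_RT)=Z({}_RR)\subseteq (R:T)_r$ or the following hold: (1) $Z({}_RT)=Z({}_RR)\oplus Z({}_RI)$. (2) $Z({}_RI)=I$, i.e., ${}_RI$ is a singular left $R$-submodule of $T$ (i.e., ${}_R(T/R)$ is a singular module). (3) $Soc({}_RR)\subseteq (R:T)_r$.
   Context: All rings are associative and unital (not necessarily commutative), and subrings contain the identity of the big ring; ''ideal'' means two-sided ideal. A maximal subring $R$ of $T$ is a proper subring with no subring strictly between $R$ and $T$. For a left $R$-module $M$, $Z({}_RM)$ is its singular submodule, i.e. the set of $m\in M$ such that $\{r\in R: rm=0\}$ is an essential left ideal of $R$, and $M$ is singular if $Z({}_RM)=M$; $Soc({}_RM)$ is its socle. $(R:T)_r=\{x\in T: xT\subseteq R\}$, which is an ideal of $R$. *)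

(* Defs.v *)
From HB Require Import structures.
From mathcomp Require Import all_boot all_order all_algebra.
From mathcomp Require Import generic_quotient ring_quotient.
From mathcomp Require Import boolp classical_sets.

Set Implicit Arguments.
Unset Strict Implicit.
Unset Printing Implicit Defensive.

Import GRing.Theory.
Local Open Scope ring_scope.
Local Open Scope classical_set_scope.
Local Open Scope quotient_scope.

(* A subring is a predicate [R : subringClosed T]; the closedness conditions
   of the library are stated for boolean predicates, and apply to [A : set T]
   through the (classical) membership predicate [[in A]]. *)

Section Modules.
Variables (A : pzRingType) (M : lmodType A).

Definition submodule (N : set M) : Prop := submod_closed [in N].

Definition nonzero (N : set M) : Prop := exists2 x, N x & x != 0.

Definition essential (N : set M) : Prop :=
  submodule N /\ forall K, submodule K -> nonzero K -> nonzero (N `&` K).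

Definition simple_submodule (N : set M) : Prop :=
  [/\ submodule N, nonzero N &
      forall K, submodule K -> K `<=` N -> nonzero K -> K = N].

(* The socle of the submodule [N]: the sum of the simple submodules of [N]. *)
Definition socle (N : set M) : set M :=
  smallest submodule (\bigcup_(S in [set S | simple_submodule S /\ S `<=` N]) S).

Definition direct_sum (N1 N2 N : set M) : Prop :=
  N = [set x + y | x in N1 & y in N2] /\ N1 `&` N2 = [set 0].

End Modules.

Section Singular.
Variables (A : pzRingType) (M : lmodType A).

(* Left ideals of [A] are the submodules of the regular left module [A^o]. *)
Definition annihilator (m : M) : set A^o := [set a | (a : A) *: m = 0].

(* [Zsing N] is the singular submodule of the submodule [N] of [M], seen as a
   subset of [M]; the singular submodule of [M] itself is [Zsing setT]. *)
Definition Zsing (N : set M) : set M :=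
  [set m | N m /\ essential (annihilator m)].

Definition singular (N : set M) : Prop := Zsing N = N.

End Singular.

Section QuotientModule.
Variables (A : pzRingType) (M : lmodType A) (N : set M) (subN : submodule N).

Definition submod_pred of submodule N : {pred M} := [in N].
Fact submod_pred_closed : submod_closed (submod_pred subN).
Proof. exact: subN. Qed.
HB.instance Definition _ :=
  GRing.isSubmodClosed.Build A M (submod_pred subN) submod_pred_closed.

Definition quotient_module : Type := Quotient.quot (submod_pred subN).
HB.instance Definition _ := EqQuotient.on quotient_module.
HB.instance Definition _ := GRing.Zmodule.on quotient_module.
Local Notation M_N := quotient_module.

Definition quot_scale (a : A) : M_N -> M_N :=
  lift_op1 M_N (fun x : M => a *: x).

Lemma pi_quot_scale a (x : M) :
  quot_scale a (\pi_M_N x) = \pi_M_N (a *: x).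
Proof.
rewrite /quot_scale -lock; apply/eqP.
rewrite -(Quotient.idealrBE (submod_pred subN)) -scalerBr rpredZ //.
by rewrite Quotient.idealrBE reprK.
Qed.

Fact quot_scaleA a b v : quot_scale a (quot_scale b v) = quot_scale (a * b) v.
Proof. by elim/quotW: v => x; rewrite !pi_quot_scale scalerA. Qed.

Fact quot_scale1 : left_id 1 quot_scale.
Proof. by elim/quotW => x; rewrite pi_quot_scale scale1r. Qed.

Fact quot_scaleDr : right_distributive quot_scale +%R.
Proof.
move=> a; elim/quotW => x; elim/quotW => y.
by rewrite !pi_quot_scale -!pi_addr pi_quot_scale scalerDr.
Qed.

Fact quot_scaleDl v : {morph quot_scale^~ v : a b / a + b}.
Proof.
by move=> a b; elim/quotW: v => x; rewrite !pi_quot_scale -pi_addr scalerDl.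
Qed.

HB.instance Definition _ := GRing.Zmodule_isLmodule.Build A M_N
  quot_scaleA quot_scale1 quot_scaleDr quot_scaleDl.

End QuotientModule.

Section Subrings.
Variables (T : pzRingType) (R : subringClosed T).

Definition subring_type : Type := {x : T | x \in R}.
HB.instance Definition _ := SubChoice.on subring_type.
HB.instance Definition _ :=
  GRing.SubChoice_isSubPzRing.Build T _ subring_type (GRing.subringClosedP R).

(* [T] as a left [R]-module, by restriction of scalars. *)
Definition over_subring of subringClosed T : Type := T.
HB.instance Definition _ := GRing.Zmodule.on (over_subring R).

Definition over_scale (r : subring_type) (x : over_subring R) : over_subring R :=
  (val r : T) * (x : T).

Fact over_scaleA r s x : over_scale r (over_scale s x) = over_scale (r * s) x.
Proof. exact: mulrA. Qed.
Fact over_scale1 : left_id 1 over_scale.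
Proof. exact: mul1r. Qed.
Fact over_scaleDr : right_distributive over_scale +%R.
Proof. by move=> r x y; apply: mulrDr. Qed.
Fact over_scaleDl x : {morph over_scale^~ x : r s / r + s}.
Proof. by move=> r s; apply: mulrDl. Qed.

HB.instance Definition _ := GRing.Zmodule_isLmodule.Build subring_type
  (over_subring R) over_scaleA over_scale1 over_scaleDr over_scaleDl.

Fact subring_submodule : submodule ([set` R] : set (over_subring R)).
Proof.
split=> [|r x y]; rewrite !inE /=; first exact: rpred0.
by move=> xR yR; apply: (@rpredD _ R) => //; apply: (@rpredM _ R) => //;
  apply: (valP r).
Qed.

Definition maximal_subring : Prop :=
  [set` R] <> setT /\
  forall S : set T, subring_closed [in S] -> [set` R] `<=` S ->
    S = [set` R] \/ S = setT.

Definition ideal (I : set T) : Prop :=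
  zmod_closed [in I] /\ forall a x, I x -> I (a * x) /\ I (x * a).

(* [(R : T)_r] *)
Definition conductor_r : set T := [set x | forall t, x * t \in R].

End Subrings.

(* Main.v *)
Require Import Defs.
From mathcomp Require Import all_boot all_order all_algebra.
From mathcomp Require Import ring_quotient boolp classical_sets.

Set Implicit Arguments.
Unset Strict Implicit.
Unset Printing Implicit Defensive.

Import GRing.Theory.
Local Open Scope ring_scope.
Local Open Scope classical_set_scope.
Local Open Scope quotient_scope.

(** Maximality forces [T = R (+) I], so that [Z(T) = Z(R) (+) Z(I)], and
    [Z(T)] is a right [T]-submodule. Hence [R + Z(I)] is a subring, and
    maximality leaves [Z(I) = 0] or [Z(I) = I]. In the first case
    [Z(T) = Z(R)] is a right [T]-submodule contained in [R]. In the second one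
    [T/R], which is isomorphic to [I], is singular, and each simple left ideal,
    being contained in every essential left ideal, annihilates [I], so that its
    product with [T = R + I] lies in [R]. *)

(** * Submodules, essential submodules and simple submodules *)

Section Submodules.
Variables (A : pzRingType) (M : lmodType A).
Implicit Types (N K : set M).

Lemma submoduleP N :
  submodule N <-> N 0 /\ forall (a : A) x y, N x -> N y -> N (a *: x + y).
Proof.
split=> [[N0 Nl]|[N0 Nl]]; split.
- by rewrite inE in N0.
- by move=> a x y Nx Ny; have := Nl a x y; rewrite !inE; apply.
- by rewrite inE.
- by move=> a x y; rewrite !inE; apply: Nl.
Qed.

Lemma submodule0 N : submodule N -> N 0.
Proof. by case/submoduleP. Qed.

Lemma submoduleD N x y : submodule N -> N x -> N y -> N (x + y).
Proof. by case/submoduleP=> _ Nl Nx Ny; rewrite -[x]scale1r; apply: Nl. Qed.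

Lemma submoduleZ N a x : submodule N -> N x -> N (a *: x).
Proof. by case/submoduleP=> N0 Nl Nx; rewrite -[_ *: _]addr0; apply: Nl. Qed.

Lemma submoduleB N x y : submodule N -> N x -> N y -> N (x - y).
Proof.
by move=> sN Nx Ny; rewrite -scaleN1r; apply: submoduleD => //; apply: submoduleZ.
Qed.

Lemma submoduleI N K : submodule N -> submodule K -> submodule (N `&` K).
Proof.
move=> sN sK; apply/submoduleP; split=> [|a x y [Nx Kx] [Ny Ky]].
  by split; apply: submodule0.
by split; apply: submoduleD => //; apply: submoduleZ.
Qed.

Lemma essential_superset N K :
  N `<=` K -> submodule K -> essential N -> essential K.
Proof.
move=> NK sK [_ eN]; split=> // L sL nL.
by have [x [Nx Lx] x0] := eN L sL nL; exists x => //; split=> //; apply: NK.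
Qed.

Lemma essentialI N K : essential N -> essential K -> essential (N `&` K).
Proof.
move=> [sN eN] [sK eK]; split=> [|L sL nL]; first exact: submoduleI.
have [x [Nx [Kx Lx]] x0] := eN _ (submoduleI sK sL) (eK L sL nL).
by exists x.
Qed.

(** Essentiality makes [N] meet [S] in a nonzero submodule, which is all of [S] by minimality. *)
Lemma simple_sub_essential (S N : set M) :
  simple_submodule S -> essential N -> S `<=` N.
Proof.
move=> [sS nS minS] [sN eN] x Sx.
have SN : N `&` S = S.
  by apply: minS; [exact: submoduleI | move=> y [] | exact: eN].
by rewrite -SN in Sx; case: Sx.
Qed.

End Submodules.

(** * Annihilators and singular submodules *)

Section Singular.
Variables (A : pzRingType) (M : lmodType A).
Implicit Types (N K : set M).

Lemma annihilator_submodule (m : M) : submodule (annihilator m).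
Proof.
apply/submoduleP; split=> [|a x y]; rewrite /annihilator /=.
  by rewrite scale0r.
move=> xm ym; change ((a * x + y : A) *: m = 0).
by rewrite scalerDl -scalerA xm ym scaler0 addr0.
Qed.

Lemma essential_annihilator0 : essential (annihilator (0 : M)).
Proof.
split=> [|K sK [x Kx x0]]; first exact: annihilator_submodule.
by exists x => //; split=> //; apply: scaler0.
Qed.

Lemma essential_annihilatorD (x y : M) :
  essential (annihilator x) -> essential (annihilator y) ->
  essential (annihilator (x + y)).
Proof.
move=> ex ey; apply: essential_superset (essentialI ex ey).
  by move=> a [ax ay]; rewrite /annihilator /= scalerDr ax ay addr0.
exact: annihilator_submodule.
Qed.

(** For a nonzero left ideal [K], test the annihilator of [x] against [K * a]: a nonzero [b * a]
    killing [x] provides a nonzero [b] in [K] killing [a *: x]. *)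
Lemma essential_annihilatorZ (a : A) (x : M) :
  essential (annihilator x) -> essential (annihilator (a *: x)).
Proof.
move=> [_ ex]; split=> [|K sK [k Kk k0]]; first exact: annihilator_submodule.
pose Ka : set A^o := [set b * a | b in K].
have sKa : submodule Ka.
  apply/submoduleP; split.
    by exists 0; [exact: submodule0 | exact: mul0r].
  move=> c _ _ [b Kb <-] [d Kd <-]; exists (c *: b + d).
    by apply: submoduleD => //; apply: submoduleZ.
  by rewrite [LHS]mulrDl -mulrA.
have [nKa|zKa] := pselect (nonzero Ka).
  have [c [xc [b Kb bac]] c0] := ex _ sKa nKa.
  rewrite -{c}bac in xc c0; exists b; first by split=> //; rewrite /annihilator /= scalerA.
  by apply: contra_neq c0 => ->; apply: mul0r.
(* Here [K * a] is zero, so any nonzero element of [K] already kills [a *: x]. *)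
exists k => //; split=> //; rewrite /annihilator /= scalerA.
have -> : (k : A) * a = 0; last exact: scale0r.
by apply/eqP; apply: contra_notT zKa => ka0; exists (k * a : A) => //; exists k.
Qed.

Lemma Zsing_submodule N : submodule N -> submodule (Zsing N).
Proof.
move=> sN; apply/submoduleP; split.
  by split; [exact: submodule0 | exact: essential_annihilator0].
move=> a x y [Nx ex] [Ny ey]; split.
  by apply: submoduleD => //; apply: submoduleZ.
by apply: essential_annihilatorD => //; apply: essential_annihilatorZ.
Qed.

Lemma Zsing_sub N : Zsing N `<=` N.
Proof. by move=> x []. Qed.

Lemma ZsingS N K : N `<=` K -> Zsing N `<=` Zsing K.
Proof. by move=> NK x [Nx ex]; split=> //; apply: NK. Qed.

(** If [a] kills [y + z], then [a *: y = - (a *: z)] lies in both [N] and [K], hence vanishes. So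
    the annihilators of [y] and [z] contain that of [y + z] and inherit its essentiality. *)
Lemma Zsing_direct_sum N K :
    submodule N -> submodule K -> direct_sum N K setT ->
  direct_sum (Zsing N) (Zsing K) (Zsing setT).
Proof.
move=> sN sK [NKT NK0]; split.
  apply/seteqP; split=> [x [_ ex]|_ [y Zy] [z Zz] <-].
    have [y Ny [z Kz yz]] : [set y + z | y in N & z in K] x by rewrite -NKT.
    suff az : annihilator x `<=` annihilator y `&` annihilator z.
      exists y; last exists z => //; split=> //; apply: essential_superset ex;
        by [move=> a /az[] | exact: annihilator_submodule].
    move=> a; rewrite /annihilator /= -yz scalerDr => ayz0.
    have ayE : (a : A) *: y = - ((a : A) *: z) by apply/eqP; rewrite -addr_eq0 ayz0.
    have ay0 : [set 0] ((a : A) *: y).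
      rewrite -NK0; split; first exact: submoduleZ.
      by rewrite ayE -scaleN1r; do 2!apply: (submoduleZ _ sK).
    by split; [exact: ay0 | rewrite -ayz0 ay0 add0r].
  have sT : submodule (@setT M) by apply/submoduleP.
  by apply: (submoduleD (Zsing_submodule sT)); [apply: ZsingS Zy | apply: ZsingS Zz].
apply/seteqP; split=> [x [[Nx _] [Kx _]]|_ ->].
  by rewrite -NK0.
by split; apply: submodule0; apply: Zsing_submodule.
Qed.

End Singular.

(** * The ring [T] as a left module over its subring [R] *)

Section Subrings.
Variables (T : pzRingType) (R : subringClosed T).
Local Notation TR := (over_subring R).

Lemma ideal_submodule (I : set T) : ideal I -> submodule (I : set TR).
Proof.
move=> [[I0 IB] IM]; apply/submoduleP; split; first by rewrite inE in I0.
have {}IB x y : I x -> I y -> I (x - y).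
  by move=> Ix Iy; have := IB x y; rewrite !inE; apply.
move=> a x y Ix Iy.
have INy : I (- (y : T)) by rewrite -sub0r; apply: IB => //; rewrite inE in I0.
by rewrite -[y]opprK; apply: IB => //; case: (IM (val a) x Ix).
Qed.

(** What kills [x] from the left also kills [x * t], so right multiplication only enlarges
    annihilators. *)
Lemma Zsing_mulr (N : set TR) :
    (forall (x t : T), N x -> N (x * t)) ->
  forall (x t : T), Zsing N x -> Zsing N (x * t).
Proof.
move=> NM x t [Nx ex]; split; first exact: NM.
apply: essential_superset ex; last exact: annihilator_submodule.
move=> a ax; change ((val a : T) * (x * t) = 0).
by rewrite mulrA (ax : (val a : T) * x = 0) mul0r.
Qed.

(** [R + J] is a subring containing [R]: in [(r + x) * (s + y) = r * s + (r * y + x * (s + y))] the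
    bracket stays in [J]. Maximality leaves only [R] and [T]. This serves for [I] and again for its
    singular submodule. *)
Lemma maximal_subring_adjoin (J : set TR) :
    maximal_subring R -> submodule J ->
    (forall (x t : T), J x -> J (x * t)) ->
  J `<=` [set` R] \/ forall t : T, exists r x : T, [/\ r \in R, J x & t = r + x].
Proof.
move=> [_ maxR] sJ JM.
pose S : set T := [set t | exists r x : T, [/\ r \in R, J x & t = r + x]].
have JMl (r x : T) : r \in R -> J x -> J (r * x).
  by move=> Rr Jx; apply: (submoduleZ (exist _ r Rr : subring_type R) sJ Jx).
have RS : [set` R] `<=` S.
  by move=> r Rr; exists r, 0; split; rewrite ?addr0 //; apply: (submodule0 sJ).
have [|SR|ST] := maxR S _ RS.
- split; rewrite /=; first by rewrite inE; apply: RS; apply: rpred1.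
    move=> u v; rewrite !inE => -[r [x [Rr Jx ->]]] [s [y [Rs Jy ->]]].
    exists (r - s), (x - y); split; first exact: rpredB.
      exact: (submoduleB sJ).
    by rewrite opprD addrACA.
  move=> u v; rewrite !inE => -[r [x [Rr Jx ->]]] [s [y [Rs Jy ->]]].
  exists (r * s), (r * y + x * (s + y)); split; first exact: rpredM.
    by apply: (submoduleD sJ); [exact: JMl | exact: JM].
  by rewrite mulrDl mulrDr addrA.
- left=> x Jx; rewrite -SR; exists 0, x; split=> //; first exact: rpred0.
  by rewrite add0r.
- by right=> t; have : S t by rewrite ST.
Qed.

Lemma conductor_r_submodule : submodule (conductor_r R : set TR).
Proof.
apply/submoduleP; split=> [t|a x y xR yR t]; first by rewrite [0 * t]mul0r rpred0.
have -> : (a *: x + y) * t = val a * (x * t) + y * t by rewrite mulrDl mulrA.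
by apply: rpredD; [apply: rpredM; [exact: (valP a) | exact: xR] | exact: yR].
Qed.

(** As [S] lies in [R], it can be read as a simple left ideal [L] of [R], which is contained in the
    essential annihilator of [m]. *)
Lemma simple_submodule_mul_singular (S : set TR) (m : TR) :
    simple_submodule S -> S `<=` [set` R] -> essential (annihilator m) ->
  forall s : T, S s -> s * m = 0.
Proof.
move=> [sS nS minS] SR em s Ss.
pose L : set (subring_type R)^o := [set a | S (val a)].
suff sL : simple_submodule L.
  have Rs := SR _ Ss.
  exact: (simple_sub_essential sL em (Ss : L (exist _ s Rs))).
split.
- apply/submoduleP; split; first exact: (submodule0 sS).
  by move=> a x y Lx Ly; apply: (submoduleD sS (submoduleZ a sS Lx)).
- by have [x Sx x0] := nS; exists (exist _ x (SR _ Sx)).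
- move=> K sK KL nK; apply/seteqP; split=> // a La.
  (* Minimality passes from [S] to [L] by pushing [K] forward along the injection [val]. *)
  suff KS : [set val b | b in K] = S.
    have [b Kb /val_inj <- //] : [set val b | b in K] (val a) by rewrite KS.
  apply: minS.
  + apply/submoduleP; split.
      by exists 0; first exact: submodule0.
    move=> c _ _ [x Kx <-] [y Ky <-]; exists (c *: x + y).
      by apply: submoduleD => //; apply: submoduleZ.
    by [].
  + by move=> _ [b Kb <-]; apply: KL.
  + have [b Kb b0] := nK; exists (val b); first by exists b.
    by apply: contra_neq b0 => vb0; apply: val_inj; rewrite vb0 rmorph0.
Qed.

(** Modulo [R], the class of [r + x] is that of [x], so its annihilator contains the essential
    annihilator of [x]. *)
Lemma singular_quotient_subring (I : set TR) :
    (forall t : T, exists r x : T, [/\ r \in R, I x & t = r + x]) ->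
  singular I -> singular (@setT (quotient_module (subring_submodule R))).
Proof.
move=> RIT sI; apply/seteqP; split=> // q _; split=> //.
elim/quotW: q => t; have [r [x [Rr Ix ->]]] := RIT t.
have [_ ex] : Zsing I x by rewrite sI.
apply: essential_superset ex; last exact: annihilator_submodule.
move=> a ax; rewrite /annihilator /=.
pose sR := subring_submodule R; pose Q := quotient_module sR.
have aE : (val a : T) * (r + x) = val a * r.
  by rewrite mulrDr (ax : (val a : T) * x = 0) addr0.
apply: etrans (pi_quot_scale sR a (r + x : T)) _.
rewrite -[RHS](raddf0 (\pi_Q)).
apply/eqP; rewrite -(Quotient.idealrBE (submod_pred sR)).
by rewrite subr0 inE /= [X in X \in R]aE rpredM // ?(valP a).
Qed.

End Subrings.

Theorem proposition3p14 (T : pzRingType) (R : subringClosed T)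
    (maxR : maximal_subring R) (I : set T) (idealI : ideal I)
    (I_neq0 : I <> [set 0]) (RI0 : [set` R] `&` I = [set 0]) :
  let TR : lmodType (subring_type R) := over_subring R in
  let RT : set TR := [set` R] in
  let IR : set TR := I in
     (Zsing (@setT TR) = Zsing RT /\ Zsing RT `<=` conductor_r R)
  \/ [/\ direct_sum (Zsing RT) (Zsing IR) (Zsing (@setT TR)),
         singular IR /\ singular (@setT (quotient_module (subring_submodule R))) &
         socle RT `<=` conductor_r R].
Proof.
move=> TR RT IR.
have sR : submodule RT := subring_submodule R.
have sI : submodule IR := ideal_submodule R idealI.
have IM (x t : T) : IR x -> IR (x * t) by move=> Ix; case: (idealI.2 t x Ix).
have sZ := Zsing_submodule sI.
have RIT (t : T) : exists r x : T, [/\ r \in R, IR x & t = r + x].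
  have [IR_R|//] := maximal_subring_adjoin maxR sI IM.
  (* [I] cannot lie in [R], or it would equal [R] intersected with [I], which is zero. *)
  case: I_neq0; rewrite -RI0; apply/seteqP; split=> [x Ix|x []//].
  by split=> //; apply: IR_R.
have dsZ : direct_sum (Zsing RT) (Zsing IR) (Zsing (@setT TR)).
  apply: Zsing_direct_sum => //; split=> //.
  apply/seteqP; split=> // t _; have [r [x [Rr Ix ->]]] := RIT t.
  by exists r => //; exists x.
have [ZR|RZT] := maximal_subring_adjoin maxR sZ (Zsing_mulr IM).
  left; have ZE : Zsing (@setT TR) = Zsing RT.
    apply/seteqP; split; last exact: ZsingS.
    rewrite dsZ.1 => _ [x Zx [y Zy <-]].
    have -> : y = 0; last by rewrite addr0.
    have : ([set` R] `&` I) y by split; [exact: ZR | exact: Zsing_sub Zy].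
    by rewrite RI0.
  split=> // x; rewrite -ZE => Zx t.
  (* The singular submodule of [T] is stable under right multiplication by [T] and equals that of
     [R], so [x * t] stays in [R]. *)
  suff : Zsing RT (x * t : T) by case.
  by rewrite -ZE; apply: Zsing_mulr.
right; have singI : singular IR.
  apply/seteqP; split=> [x []//|x Ix].
  have [r [z [Rr Zz xE]]] := RZT x.
  (* Since [r = x - z] lies in both [R] and [I], it is zero, and [x = z] is singular. *)
  have : ([set` R] `&` I) r.
    split=> //; have -> : r = x - z by rewrite xE addrK.
    by apply: (submoduleB sI) => //; apply: Zsing_sub Zz.
  by rewrite RI0 => r0; rewrite xE r0 add0r.
split=> //; first by split=> //; apply: singular_quotient_subring singI.
(* The conductor is a left [R]-submodule, so it is enough that it contains each simple [S] inside
   [R]. *)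
apply: smallest_sub; first exact: conductor_r_submodule.
move=> s [S [simS SR] Ss] t; have [r [x [Rr Ix ->]]] := RIT t.
have [_ ex] : Zsing IR x by rewrite singI.
(* As [s * x = 0], the product [s * (r + x)] reduces to [s * r]. *)
rewrite mulrDr (simple_submodule_mul_singular simS SR ex Ss) addr0.
by apply: rpredM => //; apply: SR.
Qed.
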